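(* Let $\mathcal D$ be a family of distributions. Suppose there is a learning algorithm $\mathcal A$ which for any $P\in\mathcal D$ takes $m_{\mathcal A}(\epsilon)$ samples from $P$ and in time $t_{\mathcal A}(\epsilon)$ outputs a distribution $P_1$ such that $d_{TV}(P,P_1)\le\epsilon$ with probability at least $3/4$. Suppose there is a distance approximation algorithm $\mathcal B$ for $\mathcal D$ that, given any two completely specified distributions $P_1$ and $P_2$, estimates $d_{TV}(P_1,P_2)$ up to an additive error $\epsilon$ in $t_{\mathcal B}(\epsilon,\delta)$ time with probability at least $1-\delta$. Then there is an algorithm that uses $\mathcal A$ and $\mathcal B$ as subroutines, takes $O(m_{\mathcal A}(\epsilon/4)\log\frac1\delta)$ samples from $P$, runs in $O\big(t_{\mathcal A}(\epsilon/4)\log\frac1\delta+t_{\mathcal B}(\epsilon/4,\frac{\delta}{210000\log^2(2/\delta)})\log^2\frac1\delta\big)$ time, and returns a distribution $\hat P$ such that $d_{TV}(P,\hat P)\le\epsilon$ with probability at least $1-\delta$.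
   Context: $d_{TV}$ denotes total variation distance. *)

(* Defs.v *)
From mathcomp Require Import all_boot all_order all_algebra.
From mathcomp Require Import all_classical all_reals all_analysis.

Set Implicit Arguments.
Unset Strict Implicit.
Unset Printing Implicit Defensive.

Import Order.TTheory GRing.Theory Num.Theory.
Local Open Scope classical_set_scope.
Local Open Scope ring_scope.

Definition dTV d (X : measurableType d) (R : realType) (P Q : probability X R)
  : R :=
  sup [set `|fine (P U) - fine (Q U)| | U in [set U : set X | measurable U]].

(* Expectation of f over n independent samples from P. *)
Fixpoint iid_integral d (X : measurableType d) (R : realType)
    (P : probability X R) (n : nat) : (n.-tuple X -> \bar R) -> \bar R :=
  match n return (n.-tuple X -> \bar R) -> \bar R with
  | 0%N => fun f => f [tuple]
  | n'.+1 => fun f =>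
      (\int[P]_x iid_integral P (fun t : n'.-tuple X => f (cons_tuple x t)))%E
  end.

(* H is the type of complete specifications (descriptions) of distributions;
   the distribution denoted by a specification is given separately, by a map
   H -> probability X R. The samples are drawn outside the learner, which is a
   Markov kernel from samples to specifications (its internal randomness is
   part of the kernel); lrn_kernel does not know the unknown distribution.
   Producing an output takes at least one step, hence the positivity of the
   running times. *)
Record learner d (X : measurableType d) dH (H : measurableType dH)
    (R : realType) := Learner {
  lrn_samples : R -> nat ;
  lrn_time : R -> nat ;
  lrn_time_gt0 : forall eps, (0 < lrn_time eps)%N ;
  lrn_kernel : forall eps, R.-pker ((lrn_samples eps).-tuple X) ~> H
}.

Record approximator dH (H : measurableType dH) (R : realType) := Approximator {
  apx_time : R -> R -> nat ;
  apx_time_gt0 : forall eps delta, (0 < apx_time eps delta)%N ;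
  apx_kernel : R -> R -> R.-pker (H * H)%type ~> measurableTypeR R
}.

(* Expectation of f at the output of the learner run on fresh samples from P.
   The integral of a nonnegative function is defined as a supremum over the
   simple functions below it, so for an event that is not measurable the
   integral of its indicator is its inner probability: all probabilities of
   success below are then lower bounds in the strong sense. *)
Definition lrn_integral d (X : measurableType d) dH (H : measurableType dH)
    (R : realType) (A : learner X H R) (P : probability X R) (eps : R)
    (f : H -> \bar R) : \bar R :=
  iid_integral P (fun x => (\int[lrn_kernel A eps x]_h f h)%E).

Definition learns d (X : measurableType d) dH (H : measurableType dH)
    (R : realType) (den : H -> probability X R) (D : set (probability X R))
    (A : learner X H R) : Prop :=
  forall (P : probability X R) (eps : R), D P -> 0 < eps < 1 ->
    ((3 / 4)%:E <=
     lrn_integral A P eps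
       (fun h => (\1_[set h' | dTV P (den h') <= eps] h)%R%:E))%E.

Definition approximates d (X : measurableType d) dH (H : measurableType dH)
    (R : realType) (den : H -> probability X R) (B : approximator H R) : Prop :=
  forall (h1 h2 : H) (eps delta : R), 0 < eps < 1 -> 0 < delta < 1 ->
    ((1 - delta)%:E <=
     apx_kernel B eps delta (h1, h2)
       [set r : R | `|r - dTV (den h1) (den h2)| <= eps]%R)%E.

(* A unit-cost real RAM that calls a learner and a distance approximator as
   black boxes. A program is one finite text that refers to neither the unknown
   distribution nor eps and delta: these two are its input, initially in the
   real registers 0 and 1 (the other registers hold 0). Specifications are
   opaque: the only thing a program can do with them is to store them in cells,
   pass them to the approximator, and emit them. *)
Inductive rexp : Type :=
| Lit of nat
| Reg of nat
| Add of rexp & rexp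
| Sub of rexp & rexp
| Mul of rexp & rexp
| Div of rexp & rexp
| Ln of rexp.

Inductive prog : Type :=
| Skip
| Assign of nat & rexp
| Seq of prog & prog
| IfLe of rexp & rexp & prog & prog
  (* For x e c: run c for x = 0, 1, ..., n - 1, where n is e rounded down *)
| For of nat & rexp & prog
  (* CallLearner i e: specification cell i receives the output of the learner
     run with accuracy e on fresh samples *)
| CallLearner of rexp & rexp
  (* CallApprox x e1 e2 i j: register x receives the output of the approximator
     run with accuracy e1 and failure probability e2 on cells i and j *)
| CallApprox of nat & rexp & rexp & rexp & rexp
| Emit of rexp.

Record state (R : realType) (H : Type) := State {
  reg : nat -> R ;
  cell : nat -> option H ;
  output : seq H ;
  time : nat ;
  samples : nat
}.

Section semantics.
Context (R : realType) (H : Type).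
Implicit Types (e : rexp) (s : state R H).

Fixpoint reval (v : nat -> R) e : R :=
  match e with
  | Lit n => n%:R
  | Reg x => v x
  | Add e1 e2 => reval v e1 + reval v e2
  | Sub e1 e2 => reval v e1 - reval v e2
  | Mul e1 e2 => reval v e1 * reval v e2
  | Div e1 e2 => reval v e1 / reval v e2
  | Ln e1 => ln (reval v e1)
  end.

Fixpoint rcost e : nat :=
  match e with
  | Lit _ | Reg _ => 1
  | Add e1 e2 | Sub e1 e2 | Mul e1 e2 | Div e1 e2 => (rcost e1 + rcost e2).+1
  | Ln e1 => (rcost e1).+1
  end.

Definition eval s e : R := reval (reg s) e.
Definition addr s e : nat := Num.truncn (eval s e).

Definition upd (V : Type) (f : nat -> V) (i : nat) (v : V) : nat -> V :=
  fun j => if j == i then v else f j.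

Definition tick (n : nat) s : state R H :=
  State (reg s) (cell s) (output s) (n + time s)%N (samples s).
Definition draw (m : nat) s : state R H :=
  State (reg s) (cell s) (output s) (time s) (m + samples s)%N.
Definition set_reg (x : nat) (r : R) s : state R H :=
  State (upd (reg s) x r) (cell s) (output s) (time s) (samples s).
Definition set_cell (i : nat) (h : H) s : state R H :=
  State (reg s) (upd (cell s) i (Some h)) (output s) (time s) (samples s).
Definition emit (h : H) s : state R H :=
  State (reg s) (cell s) (rcons (output s) h) (time s) (samples s).

Definition init (eps delta : R) : state R H :=
  State (upd (upd (fun _ => 0) 1 delta) 0 eps) (fun _ => None) [::] 0 0.

(* Runs of a program, branching over the answers of the two subroutines. *)
Inductive comp (T : Type) : Type :=
| Ret of T
| AskLearner of R & (H -> comp T)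
| AskApprox of R & R & H & H & (R -> comp T).

Fixpoint bind (T U : Type) (c : comp T) (k : T -> comp U) : comp U :=
  match c with
  | Ret t => k t
  | AskLearner eps f => AskLearner eps (fun h => bind (f h) k)
  | AskApprox eps delta h1 h2 f =>
      AskApprox eps delta h1 h2 (fun r => bind (f r) k)
  end.

Fixpoint iterate (T : Type) (f : nat -> T -> comp T) (ks : seq nat) (t : T)
    : comp T :=
  if ks is k :: ks' then bind (f k t) (iterate f ks') else Ret t.

Variables (tA : R -> nat) (mA : R -> nat) (tB : R -> R -> nat).

(* An instruction that reads an empty cell has no effect but its cost. *)
Fixpoint exec (c : prog) (s : state R H) : comp (state R H) :=
  match c with
  | Skip => Ret (tick 1 s)
  | Assign x e => Ret (tick (rcost e).+1 (set_reg x (eval s e) s))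
  | Seq c1 c2 => bind (exec c1 s) (exec c2)
  | IfLe e1 e2 c1 c2 =>
      let s' := tick (rcost e1 + rcost e2).+1 s in
      if eval s e1 <= eval s e2 then exec c1 s' else exec c2 s'
  | For x e c1 =>
      iterate (fun k s' => exec c1 (tick 1 (set_reg x k%:R s')))
        (iota 0 (addr s e)) (tick (rcost e).+1 s)
  | CallLearner i e =>
      AskLearner (eval s e) (fun h =>
        Ret (tick (tA (eval s e) + rcost i + rcost e).+1
          (draw (mA (eval s e)) (set_cell (addr s i) h s))))
  | CallApprox x e1 e2 i j =>
      let n := (rcost e1 + rcost e2 + rcost i + rcost j).+1 in
      match cell s (addr s i), cell s (addr s j) with
      | Some h1, Some h2 =>
          AskApprox (eval s e1) (eval s e2) h1 h2 (fun r =>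
            Ret (tick (tB (eval s e1) (eval s e2) + n)%N (set_reg x r s)))
      | _, _ => Ret (tick n s)
      end
  | Emit i =>
      let s' := tick (rcost i).+1 s in
      if cell s (addr s i) is Some h then Ret (emit h s') else Ret s'
  end.

Fixpoint all_runs (T : Type) (post : T -> Prop) (c : comp T) : Prop :=
  match c with
  | Ret t => post t
  | AskLearner _ f => forall h, all_runs post (f h)
  | AskApprox _ _ _ _ f => forall r, all_runs post (f r)
  end.

End semantics.

(* Each call of a subroutine uses fresh samples and fresh randomness. *)
Fixpoint prob d (X : measurableType d) dH (H : measurableType dH)
    (R : realType) (A : learner X H R) (B : approximator H R)
    (P : probability X R) (T : Type) (post : T -> Prop) (c : comp R H T)
    : \bar R :=
  match c with
  | Ret t => (\1_[set t' | post t'] t)%:E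
  | AskLearner eps f =>
      lrn_integral A P eps (fun h => prob A B P post (f h))
  | AskApprox eps delta h1 h2 f =>
      (\int[apx_kernel B eps delta (h1, h2)]_r prob A B P post (f r))%E
  end.

Definition run d (X : measurableType d) dH (H : measurableType dH)
    (R : realType) (A : learner X H R) (B : approximator H R) (c : prog)
    (eps delta : R) : comp R H (state R H) :=
  exec (@lrn_time _ _ _ _ _ A) (@lrn_samples _ _ _ _ _ A)
    (@apx_time _ _ _ B) c (init H eps delta).

(* The distribution returned by a program is the uniform mixture of the
   specifications h, s1, s2, ... that it has emitted (with multiplicity); a
   program that emits a single h returns the distribution denoted by h. *)
Definition mixture d (X : measurableType d) (R : realType) (H : Type)
    (den : H -> probability X R) (h : H) (s : seq H) : probability X R :=
  mnormalize (msum (fun i => den (nth h (h :: s) i)) (size s).+1) (den h).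

Definition returned d (X : measurableType d) (R : realType) (H : Type)
    (den : H -> probability X R) (s : state R H) : option (probability X R) :=
  if output s is h :: hs then Some (mixture den h hs) else None.

(* Main.v *)
Require Import Defs.
From mathcomp Require Import all_boot all_order all_algebra.
From mathcomp Require Import all_classical all_reals all_analysis.
From mathcomp Require Import measurable_realfun ring lra zify.

Set Implicit Arguments.
Unset Strict Implicit.
Unset Printing Implicit Defensive.

Import Order.TTheory GRing.Theory Num.Theory.
Local Open Scope classical_set_scope.
Local Open Scope ring_scope.

(* Run the learner m = O(log (2 / delta)) times with accuracy eps / 4. By a
   Chernoff bound, more than half of the outputs are "good", that is eps / 4-close
   to P. Estimate all m^2 mutual distances up to eps / 4 and emit every output
   that appears within 3 eps / 4 of at least half of the outputs. If all
   estimates are correct, then every good output is emitted, and every emitted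
   output has true distance at most eps to some good one, hence 5 eps / 4 to P. A
   single emitted output is thus not close enough, but at least half of the
   emitted ones are good, so by convexity their uniform mixture is within
   (eps / 4 + 5 eps / 4) / 2 < eps of P.

   Success events need not be measurable, so probabilities are lower integrals;
   the argument only uses that these are monotone and superadditive. *)

(** * Lower integrals *)

Section lower_integral.
Local Open Scope ereal_scope.
Context d (T : measurableType d) (R : realType).
Variable mu : {measure set T -> \bar R}.
Implicit Types f g : T -> \bar R.

Import HBNNSimple.

Lemma ge0_le_integral_nonmeasurable f g :
  (forall x, 0 <= f x) -> (forall x, f x <= g x) ->
  \int[mu]_x f x <= \int[mu]_x g x.
Proof.
move=> f0 fg; have g0 x : 0 <= g x by exact: le_trans (f0 x) (fg x).
rewrite !ge0_integralTE//; apply: ereal_sup_le => /= _ [h /= hf <-].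
by exists h => //= x; exact: le_trans (hf x) (fg x).
Qed.

(** For a simple function below [f] linearity is an equality; the supremum over these functions
    gives this half of linearity without measurability of [f]. *)
Lemma ge0_integral_affine_ge f (a b : R) :
  mu setT = 1 -> (0 <= a)%R -> (0 <= b)%R -> (forall x, 0 <= f x) ->
  b%:E + a%:E * \int[mu]_x f x <= \int[mu]_x (b%:E + a%:E * f x).
Proof.
move=> mu1 a0 b0 f0.
have bound (h : {nnsfun T >-> R}) : (forall x, (h x)%:E <= f x) ->
    b%:E + a%:E * sintegral mu h <= \int[mu]_x (b%:E + a%:E * f x).
  move=> hf.
  have mh : measurable_fun [set: T] (fun x => (h x)%:E).
    by apply/measurable_EFinP; exact: measurable_funPT.
  have -> : b%:E + a%:E * sintegral mu h =
      \int[mu]_x (b%:E + a%:E * (h x)%:E).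
    rewrite ge0_integralD//.
    - rewrite integral_cst// mu1 mule1 ge0_integralZl_EFin//.
        by rewrite integral_nnsfun// patch_setT.
      by move=> x _; rewrite lee_fin.
    - by move=> x _; rewrite mule_ge0 ?lee_fin.
    - by apply: measurable_funeM.
  apply: ge0_le_integral_nonmeasurable => x.
    by rewrite adde_ge0 ?mule_ge0 ?lee_fin.
  by rewrite leeD2l// lee_wpmul2l// lee_fin.
have I0 : 0 <= \int[mu]_x (b%:E + a%:E * f x).
  by apply: integral_ge0 => x _; rewrite adde_ge0 ?mule_ge0 ?lee_fin.
(* For [a = 0] the product vanishes even if the integral of [f] is infinite, so the zero simple
   function suffices. The other case divides by [a]. *)
have [a0E|a_neq0] := eqVneq a 0%R.
  have := bound nnsfun0; rewrite sintegral0 mule0 => /(_ f0).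
  by rewrite [X in _ + X * _](_ : _ = 0) ?a0E// mul0e.
rewrite (ge0_integralTE _ f0).
move: bound I0; case: (\int[mu]_x _) => [r bound _| |//]; last by move=> _ _; rewrite leey.
have a_gt0 : (0 < a)%R by rewrite lt_neqAle eq_sym a_neq0.
set S := ereal_sup _.
have : S <= ((r - b) / a)%:E.
  apply: ge_ereal_sup => _ [h /= hf <-]; have := bound h hf.
  have := sintegral_ge0 mu h.
  case: (sintegral mu h) => [s| |//]; last by rewrite gt0_muley.
  by rewrite -EFinM -EFinD !lee_fin ler_pdivlMr//; lra.
have S0 : 0 <= S.
  by apply: ereal_sup_ubound; exists nnsfun0; [|exact: sintegral0].
case: S S0 => [s| |//] // _.
by rewrite -EFinM -EFinD !lee_fin ler_pdivlMr//; lra.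
Qed.

End lower_integral.

Section iid_integral.
Local Open Scope ereal_scope.
Context d (X : measurableType d) (R : realType) (P : probability X R).

Lemma iid_integral_ge0 n (f : n.-tuple X -> \bar R) :
  (forall t, 0 <= f t) -> 0 <= iid_integral P f.
Proof.
by elim: n f => [|n IH] f f0 //=; apply: integral_ge0 => x _; exact: IH.
Qed.

Lemma iid_integral_le n (f g : n.-tuple X -> \bar R) :
  (forall t, 0 <= f t) -> (forall t, f t <= g t) ->
  iid_integral P f <= iid_integral P g.
Proof.
elim: n f g => [|n IH] f g f0 fg //=.
apply: ge0_le_integral_nonmeasurable => x; first exact: iid_integral_ge0.
exact: IH.
Qed.

Lemma iid_integral_affine_ge n (f : n.-tuple X -> \bar R) (a b : R) :
  (0 <= a)%R -> (0 <= b)%R -> (forall t, 0 <= f t) ->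
  b%:E + a%:E * iid_integral P f <= iid_integral P (fun t => b%:E + a%:E * f t).
Proof.
move=> a0 b0; elim: n f => [|n IH] f f0 //=.
apply: le_trans (ge0_integral_affine_ge (probability_setT P) a0 b0 _) _.
  by move=> x; exact: iid_integral_ge0.
apply: ge0_le_integral_nonmeasurable => x; last exact: IH.
by rewrite adde_ge0 ?mule_ge0 ?lee_fin ?iid_integral_ge0.
Qed.

End iid_integral.

Section lrn_integral.
Local Open Scope ereal_scope.
Context d (X : measurableType d) dH (H : measurableType dH) (R : realType).
Variables (A : learner X H R) (P : probability X R) (eps : R).
Implicit Types f g : H -> \bar R.

Lemma lrn_integral_ge0 f : (forall h, 0 <= f h) -> 0 <= lrn_integral A P eps f.
Proof. by move=> f0; apply: iid_integral_ge0 => t; exact: integral_ge0. Qed.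

Lemma lrn_integral_le f g : (forall h, 0 <= f h) -> (forall h, f h <= g h) ->
  lrn_integral A P eps f <= lrn_integral A P eps g.
Proof.
move=> f0 fg; apply: iid_integral_le => t; first exact: integral_ge0.
exact: ge0_le_integral_nonmeasurable.
Qed.

Lemma lrn_integral_affine_ge f (a b : R) :
  (0 <= a)%R -> (0 <= b)%R -> (forall h, 0 <= f h) ->
  b%:E + a%:E * lrn_integral A P eps f <=
  lrn_integral A P eps (fun h => b%:E + a%:E * f h).
Proof.
move=> a0 b0 f0; rewrite /lrn_integral.
set F := fun t => \int[_]_h f h.
have F0 t : 0 <= F t by exact: integral_ge0.
apply: le_trans (iid_integral_affine_ge P a0 b0 F0) _.
apply: iid_integral_le => t; last first.
  by apply: ge0_integral_affine_ge => //; exact: prob_kernel.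
by rewrite adde_ge0 ?mule_ge0 ?lee_fin ?integral_ge0.
Qed.

End lrn_integral.

(** * Rules for composing runs: invariants and success probabilities *)

Lemma all_runs_bind (R : realType) (H T U : Type) (post : U -> Prop)
    (c : Defs.comp R H T) (k : T -> Defs.comp R H U) :
  all_runs (fun t => all_runs post (k t)) c -> all_runs post (bind c k).
Proof.
by elim: c => [t|e f IH|e1 e2 h1 h2 f IH] //= + x => /(_ x); exact: IH.
Qed.

Lemma all_runs_mono (R : realType) (H T : Type) (P Q : T -> Prop)
    (c : Defs.comp R H T) :
  (forall t, P t -> Q t) -> all_runs P c -> all_runs Q c.
Proof.
move=> PQ.
by elim: c => [t|e f IH|e1 e2 h1 h2 f IH] /=; [exact: PQ| |] => + x => /(_ x) /IH.
Qed.

Lemma iterate_iotaS (R : realType) (H T : Type) (f : nat -> T -> Defs.comp R H T)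
    k n t :
  iterate f (iota k n.+1) t = bind (f k t) (iterate f (iota k.+1 n)).
Proof. by []. Qed.

(** The invariant depends on the loop counter, so that it can carry a time bound growing with each
    round. *)
Lemma all_runs_iterate (R : realType) (H T : Type) (Q : nat -> T -> Prop)
    (f : nat -> T -> Defs.comp R H T) n k t :
  (forall j s, (k <= j < k + n)%N -> Q j s -> all_runs (Q j.+1) (f j s)) ->
  Q k t -> all_runs (Q (k + n)%N) (iterate f (iota k n) t).
Proof.
elim: n k t => [|n IH] k t fQ Qt /=; first by rewrite addn0.
apply: all_runs_bind; apply: all_runs_mono (fQ k t _ Qt); last by lia.
move=> s Qs; rewrite -addSnnS; apply: IH => // j s' jn; apply: fQ; lia.
Qed.

Section prob.
Local Open Scope ereal_scope.
Context d (X : measurableType d) dH (H : measurableType dH) (R : realType).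
Variables (A : learner X H R) (B : approximator H R) (P : probability X R).

Lemma prob_ge0 T (post : T -> Prop) (c : Defs.comp R H T) : 0 <= prob A B P post c.
Proof.
elim: c => [t|e f IH|e1 e2 h1 h2 f IH] /=; first by rewrite lee_fin.
  exact: lrn_integral_ge0.
by apply: integral_ge0 => r _.
Qed.

Lemma prob_Ret T (post : T -> Prop) (t : T) (p : R) :
  post t -> (p <= 1)%R -> p%:E <= prob A B P post (Ret R H t).
Proof. by move=> pt p1; rewrite /= indicE mem_set// lee_fin. Qed.

(* [Q] is an invariant of all runs, [S] an event of probability [p]. *)
Lemma prob_bind T U (Q S : T -> Prop) (S' : U -> Prop) (c : Defs.comp R H T)
    (k : T -> Defs.comp R H U) (p q : R) :
  (0 <= p)%R -> (0 <= q)%R ->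
  all_runs Q c -> p%:E <= prob A B P S c ->
  (forall t, Q t -> S t -> q%:E <= prob A B P S' (k t)) ->
  (p * q)%:E <= prob A B P S' (bind c k).
Proof.
(* The bound [p] holds only at the root of [c]; with [prob A B P S c] in its place the claim passes
   to subtrees and induction applies. *)
move=> p0 q0 Qc Sc kS; suff: q%:E * prob A B P S c <= prob A B P S' (bind c k).
  by apply: le_trans; rewrite mulrC EFinM lee_wpmul2l ?lee_fin.
elim: c Qc {Sc} => [t|e f IH|e1 e2 h1 h2 f IH] /= Qc.
- rewrite indicE; case: (boolP (t \in _)) => [/set_mem St|_].
    by rewrite mule1; exact: kS.
  by rewrite mule0 prob_ge0.
- apply: le_trans (_ : lrn_integral A P e
      (fun h => 0%R%:E + q%:E * prob A B P S (f h)) <= _).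
    rewrite -[X in X <= _]add0e; apply: lrn_integral_affine_ge => // h.
    exact: prob_ge0.
  apply: lrn_integral_le => h; rewrite add0e; last exact: IH.
  by rewrite mule_ge0 ?lee_fin ?prob_ge0.
- apply: le_trans (_ : \int[apx_kernel B e1 e2 (h1, h2)]_r
      (0%R%:E + q%:E * prob A B P S (f r)) <= _).
    rewrite -[X in X <= _]add0e; apply: ge0_integral_affine_ge => // [|r].
      exact: prob_kernel.
    exact: prob_ge0.
  apply: ge0_le_integral_nonmeasurable => r; rewrite add0e; last exact: IH.
  by rewrite mule_ge0 ?lee_fin ?prob_ge0.
Qed.

(** Each call has fresh randomness, so a step succeeds with probability at least [q] from any state
    reached with success so far, and these bounds multiply. *)
Lemma prob_iterate T (Q S : nat -> T -> Prop) (f : nat -> T -> Defs.comp R H T)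
    (q : R) n k t :
  (0 <= q <= 1)%R ->
  (forall j s, (k <= j < k + n)%N -> Q j s -> all_runs (Q j.+1) (f j s)) ->
  (forall j s, (k <= j < k + n)%N -> Q j s -> S j s ->
     q%:E <= prob A B P (S j.+1) (f j s)) ->
  Q k t -> S k t ->
  (q ^+ n)%:E <= prob A B P (S (k + n)%N) (iterate f (iota k n) t).
Proof.
move=> /andP[q0 q1]; elim: n k t => [|n IH] k t fQ fS Qt St.
  by rewrite addn0; apply: prob_Ret => //; rewrite expr0.
rewrite exprS /=; apply: (@prob_bind _ _ (Q k.+1) (S k.+1)) => //.
- exact: exprn_ge0.
- by apply: fQ => //; lia.
- by apply: fS => //; lia.
- move=> s Qs Ss; rewrite -addSnnS; apply: IH => // j s' jn; [apply: fQ|apply: fS];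
    lia.
Qed.

Lemma prob_AskApprox T (post : T -> Prop) (den : H -> probability X R)
    (eps delta : R) (h1 h2 : H) (f : R -> Defs.comp R H T) (p : R) :
  approximates den B -> (0 < eps < 1)%R -> (0 < delta < 1)%R -> (0 <= p)%R ->
  (forall r, (`|r - dTV (den h1) (den h2)| <= eps)%R ->
     p%:E <= prob A B P post (f r)) ->
  ((1 - delta) * p)%:E <= prob A B P post (AskApprox eps delta h1 h2 f).
Proof.
move=> apx epsb deltab p0 fp /=.
set E := [set r : R | (`|r - dTV (den h1) (den h2)| <= eps)%R].
(* Accurate estimates form a closed interval, so the integral of this indicator is the kernel
   measure of [E]. *)
have mE : measurable (E : set (measurableTypeR R)).
  have -> : E = `[(dTV (den h1) (den h2) - eps)%R, (dTV (den h1) (den h2) + eps)%R]%classic.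
    by apply/seteqP; split => r; rewrite /E /= in_itv /= ler_distl.
  exact: measurable_itv.
apply: le_trans (_ : \int[apx_kernel B eps delta (h1, h2)]_r
    (0%R%:E + p%:E * (\1_E r)%:E) <= _); last first.
  apply: ge0_le_integral_nonmeasurable => r; rewrite add0e.
    by rewrite mule_ge0 ?lee_fin.
  rewrite indicE; case: (boolP (r \in E)) => [/set_mem Er|_].
    by rewrite mule1; exact: fp.
  by rewrite mule0 prob_ge0.
apply: le_trans (ge0_integral_affine_ge _ p0 _ _) => //; last first.
  exact: prob_kernel.
rewrite add0e integral_indic// setIT mulrC EFinM lee_wpmul2l ?lee_fin//.
exact: apx.
Qed.

(** The continuation is bounded below by [q + (p - q) * 1_E], with [E] the possibly nonmeasurable
    set of accurate outputs. As [q <= p], inserting the lower bound 3/4 for [E] is sound. *)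
Lemma prob_AskLearner T (post : T -> Prop) (den : H -> probability X R)
    (D : set (probability X R)) (eps : R) (f : H -> Defs.comp R H T) (p q : R) :
  learns den D A -> D P -> (0 < eps < 1)%R -> (0 <= q <= p)%R ->
  (forall h, (dTV P (den h) <= eps)%R -> p%:E <= prob A B P post (f h)) ->
  (forall h, q%:E <= prob A B P post (f h)) ->
  (3 / 4 * p + 1 / 4 * q)%:E <= prob A B P post (AskLearner eps f).
Proof.
move=> lrn DP epsb /andP[q0 qp] fp fq /=.
set E := [set h | (dTV P (den h) <= eps)%R].
apply: le_trans (_ : lrn_integral A P eps
    (fun h => q%:E + (p - q)%:E * (\1_E h)%:E) <= _); last first.
  apply: lrn_integral_le => h.
    by rewrite adde_ge0 ?mule_ge0 ?lee_fin ?subr_ge0.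
  rewrite indicE; case: (boolP (h \in E)) => [/set_mem Eh|_].
    by rewrite mule1 -EFinD addrC subrK; exact: fp.
  by rewrite mule0 adde0.
have pq0 : (0 <= p - q)%R by rewrite subr_ge0.
have E0 h : 0 <= (\1_E h)%:E :> \bar R by rewrite lee_fin.
apply: le_trans (lrn_integral_affine_ge A P eps pq0 q0 E0).
apply: le_trans (_ : q%:E + (p - q)%:E * (3 / 4)%:E <= _).
  by rewrite -EFinM -EFinD lee_fin; lra.
by rewrite leeD2l// lee_wpmul2l ?lee_fin ?subr_ge0//; exact: lrn.
Qed.

End prob.

(** * Total variation distance *)

Section total_variation.
Context d (X : measurableType d) (R : realType).
Implicit Types P Q S : probability X R.

Lemma probability_fine_itv P (U : set X) : measurable U -> 0 <= fine (P U) <= 1.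
Proof.
move=> mU; rewrite fine_ge0//= -lee_fin fineK ?probability_le1//.
exact: fin_num_measure.
Qed.

Lemma dTV_ub P Q (U : set X) :
  measurable U -> `|fine (P U) - fine (Q U)| <= dTV P Q.
Proof.
move=> mU; apply: ub_le_sup; last by exists U.
exists 1 => _ [V /= mV <-].
have /andP[? ?] := probability_fine_itv P mV.
by have /andP[? ?] := probability_fine_itv Q mV; rewrite ler_norml; lra.
Qed.

Lemma dTV_le P Q (c : R) :
  (forall U, measurable U -> `|fine (P U) - fine (Q U)| <= c) -> dTV P Q <= c.
Proof.
move=> PQc; apply: ge_sup; last by move=> _ [U /= mU <-]; exact: PQc.
by exists `|fine (P set0) - fine (Q set0)|; exists set0 => //=.
Qed.

Lemma dTV_sym P Q : dTV P Q = dTV Q P.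
Proof.
by congr sup; apply: eq_imagel => U _; rewrite distrC.
Qed.

Lemma dTV_triangle P Q S : dTV P S <= dTV P Q + dTV Q S.
Proof.
apply: dTV_le => U mU; rewrite (le_trans (ler_distD (fine (Q U)) _ _))//.
by rewrite lerD ?dTV_ub.
Qed.

Lemma mixtureE (H : Type) (den : H -> probability X R) h s (U : set X) :
  measurable U ->
  fine (mixture den h s U) =
    (\sum_(x <- h :: s) fine (den x U)) / (size s).+1%:R.
Proof.
move=> mU; rewrite /mixture /= /mnormalize /=.
have sumE V : measurable V ->
    msum (fun i => den (nth h (h :: s) i)) (size s).+1 V =
    (\sum_(x <- h :: s) fine (den x V))%:E.
  move=> mV; rewrite /msum (big_nth h) big_mkord -sumEFin.
  by apply: eq_bigr => i _; rewrite fineK// fin_num_measure.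
rewrite sumE//.
have -> : \sum_(x <- h :: s) fine (den x [set: X]) = (size s).+1%:R.
  under eq_bigr do rewrite probability_setT.
  by rewrite big_const_seq count_predT iter_addr_0.
(* The total mass is nonzero and finite, so [mnormalize] really divides instead of returning its
   default [den h]. *)
by rewrite eqe pnatr_eq0 /= sumE.
Qed.

(** Convexity: [P U] is an average of equal copies of itself, so the triangle inequality applies
    event by event. *)
Lemma dTV_mixture_le (H : Type) (den : H -> probability X R) P h s :
  dTV P (mixture den h s) <=
    (\sum_(x <- h :: s) dTV P (den x)) / (size s).+1%:R.
Proof.
apply: dTV_le => U mU; rewrite mixtureE//.
have -> : fine (P U) = (\sum_(x <- h :: s) fine (P U)) / (size s).+1%:R.
  by rewrite big_const_seq count_predT iter_addr_0 /= -[X in X / _]mulr_natr mulfK ?pnatr_eq0.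
rewrite -mulrBl normrM [X in _ * X]ger0_norm ?invr_ge0// ler_pM2r ?invr_gt0//.
rewrite -sumrB (le_trans (ler_norm_sum _ _ _))//.
by apply: ler_sum => x _; exact: dTV_ub.
Qed.

End total_variation.

(* Only averaging gives [4 * r]: the individual members are merely guaranteed to
   be [5 * r]-close. *)
Lemma dTV_mixture_majority d (X : measurableType d) (R : realType) (H : Type)
    (den : H -> probability X R) (P : probability X R) (r : R) h s :
  let good := fun x => `[< dTV P (den x) <= r >] in
  all (fun x => `[< dTV P (den x) <= 5 * r >]) (h :: s) ->
  ((size s).+1 <= 2 * count good (h :: s))%N -> 0 <= r ->
  dTV P (mixture den h s) <= 4 * r.
Proof.
move=> good near half r0; apply: le_trans (dTV_mixture_le _ _ _ _) _.
rewrite ler_pdivrMr//.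
(* Every member contributes at most [5 * r], and a good one saves [4 * r] of it. With half of them
   good the average is at most [3 * r]. *)
have : \sum_(x <- h :: s) dTV P (den x) <=
    5 * r * (size (h :: s))%:R - 4 * r * (count good (h :: s))%:R.
  elim: (h :: s) near => [|x l IH] /=; first by rewrite big_nil; lra.
  case/andP=> /asboolP nx /IH l5; rewrite big_cons.
  rewrite natrD -[in X in _ <= X]addn1 natrD.
  rewrite {1}/good; case: asboolP => /= gx; lra.
move=> /le_trans; apply.
have : ((size s).+1%:R : R) <= 2 * (count good (h :: s))%:R.
  by rewrite -natrM ler_nat.
move: (count _ _) => c sc /=.
have : r * (size s).+1%:R <= r * (2 * c%:R) by rewrite ler_wpM2l.
have : 0 <= r * c%:R by rewrite mulr_ge0.
lra.
Qed.

(** Inclusion-exclusion. It provides a good output among the voters of an emitted one. *)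
Lemma count_cap_majority (T : Type) (p q : pred T) (s : seq T) :
  (size s < count p s + count q s)%N -> has (predI p q) s.
Proof.
rewrite has_count => pq; have := count_predUI p q s; have := count_size (predU p q) s.
lia.
Qed.

(** * The deviation bound and the choice of parameters *)

Section deviation.
Context (R : realType).
Implicit Types b k m : nat.

(* After [b] bad trials, if each of the [k] remaining ones is bad with probability
   at most 1/4, then E[4 ^ (number of bad trials)] <= 4 ^ b * (3 / 4 + 4 / 4) ^ k,
   and if at least half of [m] trials are bad, then this variable is at least
   4 ^ (m / 2) = 2 ^ m. *)
Definition deviation b k m : R := 4 ^+ b * (7 / 4) ^+ k / 2 ^+ m.

Lemma deviation_ge1 b m : (m <= 2 * b)%N -> 1 <= deviation b 0 m.
Proof.
move=> mb; rewrite /deviation expr0 mulr1 ler_pdivlMr ?exprn_gt0// mul1r.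
rewrite (_ : 4 = 2 ^+ 2); last by lra.
by rewrite -exprM; apply: ler_weXn2l => //; lra.
Qed.

Lemma deviation_ge0 b k m : 0 <= deviation b k m.
Proof. by rewrite /deviation !mulr_ge0 ?invr_ge0 ?exprn_ge0//; lra. Qed.

(** Since 7/4 = 3/4 * 1 + 1/4 * 4, the potential is preserved on average by a trial that is bad with
    probability 1/4. *)
Lemma deviationS b k m :
  deviation b k.+1 m = 3 / 4 * deviation b k m + 1 / 4 * deviation b.+1 k m.
Proof. by rewrite /deviation !exprS; lra. Qed.

(** [1 - deviation] can be negative, while [prob_AskLearner] wants nonnegative bounds; clipping at 0
    keeps the recursion valid. *)
Lemma deviation_clipped (x y : R) :
  1 - (3 / 4 * x + 1 / 4 * y) <=
  3 / 4 * Num.max 0 (1 - x) + 1 / 4 * Num.max 0 (1 - y).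
Proof.
have : 1 - x <= Num.max 0 (1 - x) by rewrite le_max lexx orbT.
have : 1 - y <= Num.max 0 (1 - y) by rewrite le_max lexx orbT.
lra.
Qed.

Lemma deviation_mono b k m : deviation b k m <= deviation b.+1 k m.
Proof.
have := deviation_ge0 b k m; rewrite /deviation exprS; set x := _ ^+ b.
by rewrite -!mulrA; set y := x * _; lra.
Qed.

(** The base is (7/4) / 2 = 1 - 1/8, which is at most exp (-1/8). *)
Lemma deviation_expR m : deviation 0 m m <= expR (- (m%:R / 8)).
Proof.
rewrite /deviation expr0 mul1r -expr_div_n (_ : - _ = m%:R * - (1 / 8)); last first.
  by lra.
rewrite expRM_natl; apply: lerXn2r; rewrite ?nnegrE ?expR_ge0//.
by apply: le_trans (expR_ge1Dx _); lra.
Qed.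

End deviation.

Section parameters.
Context (R : realType) (delta : R) (hdelta : 0 < delta < 1).

Let L := ln (2 / delta).
(** Rounding down loses less than one round, and [L >= 1 / 2] gives [10 * L - 1 >= 8 * L]; hence exp
    (-m/8) is at most exp (-L) = delta / 2. *)
Let n := 10 * L.
Let m := Num.truncn n.
Let dl := delta / (21 * 10 ^+ 4 * L ^+ 2).

(** Apply ln (1 + x) <= x at x = -1/2. *)
Lemma ln2_ge_half : 1 / 2 <= ln (2 : R).
Proof.
have -> : (2 : R) = (1 + - (1 / 2))^-1 by field.
rewrite lnV ?posrE; last by lra.
by rewrite lerNr; apply: le_trans (le_ln1Dx _) _; lra.
Qed.

Lemma ln_2div_ge_half : 1 / 2 <= L.
Proof.
apply: le_trans ln2_ge_half _; have /andP[d0 d1] := hdelta.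
by rewrite /L ler_ln ?posrE ?divr_gt0// ler_pdivlMr//; lra.
Qed.

Lemma truncn_rounds : (1 <= m)%N /\ m%:R <= n < m%:R + 1.
Proof.
have L0 := ln_2div_ge_half.
have n0 : 0 <= n by rewrite /n; lra.
have /andP[mn nm] := truncn_itv n0; rewrite -/m in mn nm.
rewrite mn natr1 nm; split=> //.
rewrite lt0n; apply/eqP => m0; move: nm; rewrite m0 /n; lra.
Qed.

Lemma failure_probability_bounds : 0 < dl < 1.
Proof.
have L0 := ln_2div_ge_half; have /andP[d0 d1] := hdelta.
have LL : 1 / 4 <= L ^+ 2 by nra.
have D0 : 1 < 21 * 10 ^+ 4 * L ^+ 2 by lra.
rewrite /dl divr_gt0 ?(lt_trans _ D0)//= ltr_pdivrMr ?(lt_trans _ D0)//; lra.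
Qed.

(** Bernoulli's inequality acts as a union bound: at most [100 * L ^+ 2] calls fail with total
    probability at most 100 / 210000 * delta. *)
Lemma approximator_failures : 1 - delta / 2 <= (1 - dl) ^+ (m * m).
Proof.
have bernoulli k : 1 - k%:R * dl <= (1 - dl) ^+ k.
  have /andP[/ltW dl0 dl1] := failure_probability_bounds.
  elim: k => [|k IH]; first by rewrite expr0; lra.
  rewrite exprS -natr1.
  have := @ler_wpM2l _ (1 - dl) _ _ _ IH; rewrite subr_ge0 ltW// => /(_ isT).
  have : 0 <= k%:R * dl * dl by do 2?[apply: mulr_ge0 => //].
  lra.
apply: le_trans (bernoulli _).
have [_ /andP[mn _]] := truncn_rounds.
have L0 := ln_2div_ge_half; have /andP[d0 d1] := hdelta.
have mm : (m * m)%:R <= 100 * L ^+ 2.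
  by rewrite natrM expr2; have := ler_pM (ler0n R m) (ler0n R m) mn mn; rewrite /n; lra.
have LL : 0 < L ^+ 2 by rewrite exprn_gt0//; lra.
rewrite lerD2l lerN2 /dl mulrA ler_pdivrMr; last by rewrite mulr_gt0//; lra.
have := ler_wpM2r (ltW d0) mm.
have : 0 <= L ^+ 2 * delta by rewrite mulr_ge0 ?ltW.
lra.
Qed.

Lemma learner_failures : deviation R 0 m m <= delta / 2.
Proof.
have [_ /andP[_ nm]] := truncn_rounds.
have L0 := ln_2div_ge_half; have /andP[d0 d1] := hdelta.
apply: le_trans (deviation_expR R m) _.
rewrite -[leRHS]lnK ?posrE ?divr_gt0// ler_expR.
rewrite -[delta / 2]invf_div lnV ?posrE ?divr_gt0// -/L.
by move: nm; rewrite /n; lra.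
Qed.

Lemma success_probability :
  1 - delta <= (1 - deviation R 0 m m) * (1 - dl) ^+ (m * m).
Proof.
have := learner_failures; have := approximator_failures.
have := deviation_ge0 R 0 m m; have /andP[? ?] := hdelta.
by move: (deviation _ _ _ _) (_ ^+ _) => x y x0 y1 x1; nra.
Qed.

End parameters.

(** The summand ln 2 is absorbed because ln (1 / delta) is at least the positive number ln (1 /
    delta0). *)
Lemma ln_2div_le (R : realType) (delta0 delta : R) :
  0 < delta0 < 1 -> 0 < delta <= delta0 ->
  ln (2 / delta) <= (1 + ln 2 / ln (1 / delta0)) * ln (1 / delta).
Proof.
move=> /andP[d00 d01] /andP[d0 dd].
have l0 : 0 < ln (1 / delta0) by rewrite ln_gt0// ltr_pdivlMr// mul1r.
have ll : ln (1 / delta0) <= ln (1 / delta).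
  by rewrite ler_ln ?posrE ?divr_gt0// ler_pM2l// lef_pV2.
rewrite -[2 / delta](_ : 2 * (1 / delta) = _); last by rewrite mul1r.
rewrite lnM ?posrE ?divr_gt0//.
move: (ln (1 / delta)) ll => x ll.
rewrite [leRHS]mulrDl mul1r addrC lerD2l mulrAC ler_pdivlMr//.
by rewrite ler_wpM2l// (le_trans _ (ln2_ge_half R)).
Qed.

(** * The program and its invariants *)

(* Registers: 2 real number of rounds, 3 accuracy, 4 failure probability,
   5 and 6 loop indices, 7 estimate, 8 votes for the current cell, 9 number of
   specifications emitted so far. *)
Definition sample_step := CallLearner (Reg 5) (Reg 3).

(** Threshold 3: two good outputs are within [2 * e], so an estimate with error [e] passes;
    conversely, passing certifies a true distance of at most [4 * e]. *)
Definition vote_step :=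
  Seq (CallApprox 7 (Reg 3) (Reg 4) (Reg 5) (Reg 6))
    (IfLe (Reg 7) (Mul (Lit 3) (Reg 3)) (Assign 8 (Add (Reg 8) (Lit 1))) Skip).

(** Register 2 holds the unrounded [n]. Twice the votes is an integer, so [n <= 2 * c] implies
    [m <= 2 * c] and follows from [m < 2 * c]. *)
Definition emit_step :=
  IfLe (Reg 2) (Mul (Lit 2) (Reg 8))
    (Seq (Emit (Reg 5)) (Assign 9 (Add (Reg 9) (Lit 1)))) Skip.

Definition vote :=
  Seq (Assign 8 (Lit 0)) (Seq (For 6 (Reg 2) vote_step) emit_step).

(* Ensures that something is returned even when the estimates are wrong. *)
Definition fallback := IfLe (Lit 1) (Reg 9) Skip (Emit (Lit 0)).

Definition tournament :=
  Seq (For 5 (Reg 2) sample_step) (Seq (For 5 (Reg 2) vote) fallback).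

Definition setup :=
  let l := Ln (Div (Lit 2) (Reg 1)) in
  Seq (Assign 2 (Mul (Lit 10) l))
    (Seq (Assign 3 (Div (Reg 0) (Lit 4)))
       (Assign 4 (Div (Reg 1)
          (Mul (Mul (Lit 21) (Mul (Lit 100) (Lit 100))) (Mul l l))))).

Section exec.
Context (R : realType) (H : Type) (tA mA : R -> nat) (tB : R -> R -> nat).
Local Notation exec := (@exec R H tA mA tB).

Lemma exec_Seq c1 c2 s : exec (Seq c1 c2) s = bind (exec c1 s) (exec c2).
Proof. by []. Qed.

Lemma exec_For x e c s :
  exec (For x e c) s =
  iterate (fun k s' => exec c (tick 1 (set_reg x k%:R s')))
    (iota 0 (addr s e)) (tick (rcost e).+1 s).
Proof. by []. Qed.

Lemma exec_Assign_Seq x e c s :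
  exec (Seq (Assign x e) c) s =
  exec c (tick (rcost e).+1 (set_reg x (Defs.eval s e) s)).
Proof. by []. Qed.

Definition sampled k h s : state R H :=
  tick (tA (reg s 3) + 3) (draw (mA (reg s 3))
    (set_cell k h (tick 1 (set_reg 5 k%:R s)))).

Lemma exec_sample_step k s :
  exec sample_step (tick 1 (set_reg 5 k%:R s)) =
  AskLearner (reg s 3) (fun h => Ret R H (sampled k h s)).
Proof.
by rewrite /sampled /= /addr /Defs.eval /= natrK -addnA -addnS.
Qed.

Lemma exec_vote_step s i j h1 h2 :
  reg s 5 = i%:R -> reg s 6 = j%:R -> cell s i = Some h1 -> cell s j = Some h2 ->
  exec vote_step s =
  AskApprox (reg s 3) (reg s 4) h1 h2 (fun r =>
    exec (IfLe (Reg 7) (Mul (Lit 3) (Reg 3))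
            (Assign 8 (Add (Reg 8) (Lit 1))) Skip)
      (tick (tB (reg s 3) (reg s 4) + 5)%N (set_reg 7 r s))).
Proof.
move=> r5 r6 c1 c2; rewrite /vote_step exec_Seq /=.
by rewrite /addr /Defs.eval /= r5 r6 !natrK c1 c2.
Qed.

End exec.

(** * Output, sample count and running time on every run *)

Section tournament.
Context (R : realType) (H : Type) (tA mA : R -> nat) (tB : R -> R -> nat).
Variables (n e dl : R).
Local Notation exec := (@exec R H tA mA tB).
Local Notation m := (Num.truncn n).
Implicit Types (s : state R H) (Tm : nat).

Definition frame s := [/\ reg s 2 = n, reg s 3 = e & reg s 4 = dl].

Definition sampling Tm k s :=
  [/\ frame s, (forall i, (i < k)%N -> cell s i <> None),
      output s = [::] /\ reg s 9 = 0, samples s = (k * mA e)%N &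
      (time s <= Tm)%N].

(** Naming the cell contents [hs] fixes the sampled specifications; during voting only the estimates
    remain random. *)
Definition voting (hs : nat -> H) Tm s :=
  [/\ frame s, (forall i, (i < m)%N -> cell s i = Some (hs i)),
      reg s 9 = (size (output s))%:R, samples s = (m * mA e)%N &
      (time s <= Tm)%N].

Definition voting_for (hs : nat -> H) (i : nat) (out : seq H) Tm s :=
  [/\ voting hs Tm s, reg s 5 = i%:R & output s = out].

Lemma frame_addr s : frame s -> addr s (Reg 2) = m.
Proof. by case=> r2 _ _; rewrite /addr /Defs.eval /= r2. Qed.

Lemma all_runs_sample_step Tm k s : sampling Tm k s ->
  all_runs (sampling (tA e + 4 + Tm) k.+1)
    (exec sample_step (tick 1 (set_reg 5 k%:R s))).
Proof.
case=> -[r2 r3 r4] cs [os r9] ss ts; rewrite exec_sample_step /= => h.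
rewrite /sampled r3; split=> //=; try lia.
by move=> i ik; rewrite /upd; case: eqVneq => // ik'; apply: cs; lia.
Qed.

(** The overhead 15 is 1 for the loop, 5 for the call, 5 for the comparison and 4 for the
    increment. *)
Lemma all_runs_vote_step hs i out Tm j s : (i < m)%N -> (j < m)%N ->
  voting_for hs i out Tm s ->
  all_runs (voting_for hs i out (tB e dl + 15 + Tm))
    (exec vote_step (tick 1 (set_reg 6 j%:R s))).
Proof.
move=> im jm [[[r2 r3 r4] cs r9 ss ts] r5 os].
rewrite (@exec_vote_step _ _ _ _ _ _ i j (hs i) (hs j)) ?cs//= => r.
rewrite /Defs.eval /= /upd /= r3 r4.
by case: ifP => _ /=; do 3?split=> //=; lia.
Qed.

Lemma all_runs_emit_step hs i out Tm s : (i < m)%N -> voting_for hs i out Tm s ->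
  all_runs (voting hs (11 + Tm)) (exec emit_step s).
Proof.
move=> im [[[r2 r3 r4] cs r9 ss ts] r5 os].
rewrite /emit_step /= /Defs.eval /=; case: ifP => _ /=; last first.
  by split=> //=; lia.
rewrite /addr /Defs.eval /= r5 natrK cs//=.
split=> //=; try lia.
by rewrite /Defs.eval /= /upd /= r9 size_rcons natr1.
Qed.

(** Here 16 = 3 + 2 + 11: entering the round, the inner loop header, and [emit_step]. *)
Definition vote_time := (m * (tB e dl + 15) + 16)%N.

Lemma all_runs_vote_loop hs i out Tm s : (i < m)%N ->
  voting_for hs i out Tm s ->
  all_runs (voting_for hs i out (m * (tB e dl + 15) + 2 + Tm))
    (exec (For 6 (Reg 2) vote_step) s).
Proof.
move=> im Qs; have fs : frame s by case: Qs => -[].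
rewrite exec_For (frame_addr fs).
pose Q k := voting_for hs i out (k * (tB e dl + 15) + 2 + Tm).
apply: (@all_runs_iterate _ _ _ Q _ m 0); last first.
  by case: Qs => -[? ? ? ? ?] ? ?; split=> //; split.
move=> j s' jm; rewrite /Q mulSn -2!(addnA (_ + 15)) => ?.
by apply: all_runs_vote_step.
Qed.

Lemma voting_enter hs i Tm s : voting hs Tm s ->
  voting_for hs i (output s) (3 + Tm)
    (tick 2 (set_reg 8 0 (tick 1 (set_reg 5 i%:R s)))).
Proof. by case=> -[r2 r3 r4] cs r9 ss ts; split=> //; split=> //=; lia. Qed.

Lemma all_runs_vote hs i Tm s : (i < m)%N -> voting hs Tm s ->
  all_runs (voting hs (vote_time + Tm)) (exec vote (tick 1 (set_reg 5 i%:R s))).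
Proof.
move=> im Qs; rewrite /vote exec_Assign_Seq exec_Seq; apply: all_runs_bind.
apply: all_runs_mono (all_runs_vote_loop im (voting_enter i Qs)) => s' Qs'.
apply: all_runs_mono (all_runs_emit_step im Qs') => s'' [? ? ? ? ?].
by split=> //; rewrite /vote_time; lia.
Qed.

Lemma all_runs_votes hs Tm s : voting hs Tm s ->
  all_runs (voting hs (m * vote_time + 2 + Tm)) (exec (For 5 (Reg 2) vote) s).
Proof.
move=> Qs; have fs : frame s by case: Qs.
rewrite exec_For (frame_addr fs).
pose Q k := voting hs (k * vote_time + 2 + Tm).
apply: (@all_runs_iterate _ _ _ Q _ m 0); last by case: Qs => *; split.
move=> j s' jm; rewrite /Q mulSn -2!(addnA vote_time) => ?.
by apply: all_runs_vote.
Qed.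

Lemma all_runs_samples Tm s : sampling Tm 0 s ->
  all_runs (sampling (m * (tA e + 4) + 2 + Tm) m)
    (exec (For 5 (Reg 2) sample_step) s).
Proof.
move=> Qs; have fs : frame s by case: Qs.
rewrite exec_For (frame_addr fs).
pose Q k := sampling (k * (tA e + 4) + 2 + Tm) k.
apply: (@all_runs_iterate _ _ _ Q _ m 0); last by case: Qs => *; split.
move=> j s' jm; rewrite /Q mulSn -2!(addnA (_ + 4)) => ?.
by apply: all_runs_sample_step.
Qed.

Lemma sampling_voting Tm s : (0 < m)%N -> sampling Tm m s ->
  exists hs, voting hs Tm s.
Proof.
move=> m0 [fs cs [os r9] ss ts].
have [h0 h0E] : exists h, cell s 0%N = Some h.
  by case: (cell s 0%N) (cs _ m0) => // h _; exists h.
(* Cell 0 is filled since [m] is positive; its content serves as default outside the sampled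
   range. *)
exists (fun i => odflt h0 (cell s i)); split=> //; last by rewrite os.
by move=> i /cs; case: (cell s i).
Qed.

Lemma all_runs_fallback hs Tm s : (0 < m)%N -> voting hs Tm s ->
  all_runs (fun s' => [/\ output s' <> [::], samples s' = (m * mA e)%N &
                      (time s' <= 5 + Tm)%N]) (exec fallback s).
Proof.
move=> m0 [fs cs r9 ss ts].
rewrite /fallback /= /Defs.eval /= r9 ler1n; case: ifP => /= o0.
  by split=> //=; [case: (output s) o0|lia].
rewrite /addr /Defs.eval /= truncn0 cs//=.
split=> //=.
by case: (output s).
Qed.

Lemma all_runs_tournament Tm s : (0 < m)%N -> sampling Tm 0 s ->
  all_runs (fun s' => [/\ output s' <> [::], samples s' = (m * mA e)%N &
      (time s' <= m * (tA e + 4) + m * vote_time + 9 + Tm)%N])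
    (exec tournament s).
Proof.
move=> m0 Qs; rewrite /tournament exec_Seq; apply: all_runs_bind.
apply: all_runs_mono (all_runs_samples Qs) => s1 Qs1.
have [hs Q1] := sampling_voting m0 Qs1.
rewrite exec_Seq; apply: all_runs_bind.
apply: all_runs_mono (all_runs_votes Q1) => s2 Q2.
apply: all_runs_mono (all_runs_fallback m0 Q2) => s3 [? ? ?].
by split=> //; lia.
Qed.

End tournament.

(** * Probability of success *)

Section success.
Context d (X : measurableType d) dH (H : measurableType dH) (R : realType).
Variables (den : H -> probability X R) (D : set (probability X R)).
Variables (A : learner X H R) (B : approximator H R) (P : probability X R).
Hypotheses (learnsA : learns den D A) (approxB : approximates den B) (DP : D P).
Variables (n e dl : R).
Hypothesis e01 : 0 < e < 1.
Local Notation m := (Num.truncn n).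
Local Notation tA := (@lrn_time _ _ _ _ _ A).
Local Notation mA := (@lrn_samples _ _ _ _ _ A).
Local Notation tB := (@apx_time _ _ _ B).
Local Notation exec := (@exec R H tA mA tB).
Local Notation prob := (prob A B P).
Local Notation voting := (voting mA n e dl).
Local Notation voting_for := (voting_for mA n e dl).
Local Notation sampling := (sampling mA n e dl).
Implicit Types s : state R H.

Definition good (h : H) : bool := `[< dTV P (den h) <= e >].

Definition good_cells k s := count (fun i => oapp good false (cell s i)) (iota 0 k).

Lemma count_iotaS (p : pred nat) k :
  count p (iota 0 k.+1) = (count p (iota 0 k) + p k)%N.
Proof. by rewrite -addn1 iotaD count_cat /= addn0. Qed.

(** Chernoff's bound by induction on the [j] remaining calls, with [b] bounding the bad outputs so
    far. At the end either the good ones are a strict majority, or [M <= 2 * b] and the bound is at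
    most 0. *)
Lemma prob_samples_loop M j k b Tm s :
  (k + j = M)%N -> sampling Tm k s -> (k <= good_cells k s + b)%N ->
  ((1 - deviation R b j M)%:E <=
    prob (fun s' => M < 2 * good_cells M s')%N
      (iterate (fun i s' => exec sample_step (tick 1 (set_reg 5 i%:R s')))
         (iota k j) s))%E.
Proof.
elim: j k b Tm s => [|j IH] k b Tm s kj Qs kb.
  rewrite addn0 in kj; rewrite -kj /=.
  have [kg|kg] := ltnP k (2 * good_cells k s).
    by apply: (prob_Ret A B P) => //; rewrite gerBl deviation_ge0.
  apply: (@le_trans _ _ 0%E); last by rewrite lee_fin.
  by rewrite lee_fin subr_le0; apply: deviation_ge1; lia.
have [r2 r3 r4] : frame n e dl s by case: Qs.
have Qs' := all_runs_sample_step tA tB Qs.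
rewrite exec_sample_step r3 in Qs'; rewrite iterate_iotaS exec_sample_step r3.
rewrite [bind _ _]/=.
have g' h : good_cells k.+1 (sampled tA mA k h s) = (good_cells k s + good h)%N.
  rewrite /good_cells count_iotaS /= /upd eqxx /=.
  congr (_ + _)%N; apply: eq_in_count => i; rewrite mem_iota => /andP[_ ik].
  by case: eqVneq ik => // ->; rewrite add0n ltnn.
pose p : R := Num.max 0 (1 - deviation R b j M).
pose q : R := Num.max 0 (1 - deviation R b.+1 j M).
apply: (@le_trans _ _ (3 / 4 * p + 1 / 4 * q)%:E).
  by rewrite lee_fin deviationS deviation_clipped.
apply: (prob_AskLearner learnsA) => // [|h gh|h].
- rewrite le_max lexx /= ge_max !le_max lexx /=; apply/orP; right.
  by rewrite lerD2l lerN2 deviation_mono.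
- rewrite EFin_max ge_max prob_ge0 /=.
  apply: IH (Qs' h) _; first by rewrite addSnnS.
  by rewrite g' /good asboolT//; lia.
- rewrite EFin_max ge_max prob_ge0 /=.
  apply: IH (Qs' h) _; first by rewrite addSnnS.
  by rewrite g'; lia.
Qed.

Lemma prob_samples Tm s : sampling Tm 0 s ->
  ((1 - deviation R 0 m m)%:E <=
    prob (fun s' => m < 2 * good_cells m s')%N
      (exec (For 5 (Reg 2) sample_step) s))%E.
Proof.
move=> Qs; have fs : frame n e dl s by case: Qs.
rewrite exec_For (frame_addr fs).
have Qs' : sampling (2 + Tm) 0 (tick 2 s) by case: Qs => *; split.
exact: prob_samples_loop Qs' _.
Qed.

Variable hs : nat -> H.
Local Notation good_count k := (count (fun i => good (hs i)) (iota 0 k)).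
Hypothesis majority : (m < 2 * good_count m)%N.

(** At [i = m] the last two clauses and [majority] give the emitted list a strict good majority: its
    size is at most [m], and every good output is in it. *)
Definition elected i s :=
  [/\ all (fun h => `[< dTV P (den h) <= 5 * e >]) (output s),
      (size (output s) <= i)%N &
      (good_count i <= count good (output s))%N].

Lemma prob_fallback Tm s : voting hs Tm s -> elected m s ->
  (1%:E <= prob (fun s' => exists2 Phat : probability X R,
      returned den s' = Some Phat & (dTV P Phat <= 4 * e)%R)
    (exec fallback s))%E.
Proof.
case=> [fs cs r9 ss ts] [near sz cnt].
have szc : (size (output s) < 2 * count good (output s))%N by lia.
rewrite /fallback /= /Defs.eval /= r9 ler1n.
have -> : (0 < size (output s))%N by have := count_size good (output s); lia.
apply: (prob_Ret A B P) => //; rewrite /returned /=.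
case: (output s) near szc => [//|h l] near szc.
exists (mixture den h l) => //; apply: dTV_mixture_majority => //.
- exact: ltnW.
- by have /andP[/ltW] := e01.
Qed.

Hypothesis dl01 : 0 < dl < 1.
Hypothesis mn : m%:R <= n < m%:R + 1.

Definition close i j : bool := `[< dTV (den (hs i)) (den (hs j)) <= 4 * e >].

(** The tally depends on the random estimates, so it is only enclosed: a good candidate has the
    votes of all good cells, and only truly close cells vote. *)
Definition tallied i j s := exists c : nat,
  [/\ reg s 8 = c%:R, (good (hs i) -> good_count j <= c)%N &
      (c <= count (close i) (iota 0 j))%N].

Lemma prob_vote_step i out Tm j s : (i < m)%N -> (j < m)%N ->
  voting_for hs i out Tm s -> tallied i j s ->
  ((1 - dl)%:E <= prob (tallied i j.+1)
    (exec vote_step (tick 1 (set_reg 6 j%:R s))))%E.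
Proof.
move=> im jm [[[r2 r3 r4] cs r9 ss ts] r5 os] [c [r8 cg cc]].
rewrite (@exec_vote_step _ _ _ _ _ _ i j (hs i) (hs j)) ?cs//=.
rewrite /upd /= r3 r4 -[1 - dl]mulr1.
apply: (prob_AskApprox approxB) => // r.
rewrite ler_distl => /andP[rd dr].
rewrite /Defs.eval /= /upd /= r3.
have [r3e|r3e] := leP r (3 * e); apply: (prob_Ret A B P) => //.
  exists c.+1; rewrite !count_iotaS; split.
  - by rewrite /= /Defs.eval /= /upd /= r8 natr1.
  - by move=> /cg; case: good => /=; lia.
  - by rewrite {2}/close asboolT ?addn1//; lra.
exists c; rewrite !count_iotaS; split.
- by rewrite /= /upd /= r8.
- move=> gi; have cgi := cg gi; rewrite /good asboolF ?addn0// => gj.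
  move: gi => /asboolP gi.
  have := dTV_triangle (den (hs i)) P (den (hs j)).
  by rewrite (dTV_sym _ P); lra.
- exact: leq_trans cc (leq_addr _ _).
Qed.

Lemma prob_vote_loop i out Tm s : (i < m)%N ->
  voting_for hs i out Tm s -> tallied i 0 s ->
  (((1 - dl) ^+ m)%:E <= prob (tallied i m)
    (exec (For 6 (Reg 2) vote_step) s))%E.
Proof.
move=> im Qs Ss; have fs : frame n e dl s by case: Qs => -[].
rewrite exec_For (frame_addr fs).
pose Q k := voting_for hs i out (k * (tB e dl + 15) + 2 + Tm).
apply: (@prob_iterate _ _ _ _ _ A B P _ Q (tallied i) _ _ _ 0).
- by have /andP[? ?] := dl01; lra.
- move=> j s' jm; rewrite /Q mulSn -2!(addnA (_ + 15)) => ?.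
  by apply: all_runs_vote_step.
- by move=> j s' jm Qs' Ss'; exact: prob_vote_step Qs' Ss'.
- by case: Qs => -[? ? ? ? ?] ? ?; split=> //; split.
- by [].
Qed.

Lemma prob_emit_step i out Tm s s0 : (i < m)%N ->
  voting_for hs i out Tm s -> tallied i m s -> output s0 = out -> elected i s0 ->
  (1%:E <= prob (elected i.+1) (exec emit_step s))%E.
Proof.
move=> im [[[r2 r3 r4] cs r9 ss ts] r5 os] [c [r8 cg cc]] os0 [near sz cnt].
rewrite os0 -os in near sz cnt.
have /andP[mn1 mn2] := mn.
rewrite /emit_step /= /Defs.eval /= r2 r8; case: ifP => [nc|/negbT nc].
  rewrite /addr /Defs.eval /= r5 natrK cs//=.
  apply: (prob_Ret A B P) => //; split; rewrite ?count_iotaS /=.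
  - rewrite all_rcons near andbT; apply/asboolP.
    have mc : (m <= 2 * c)%N.
      by rewrite -(ler_nat R) natrM; exact: le_trans mn1 nc.
    (* At least half of the cells are close to candidate [i] and more than half are good, so some
       good [j] is close; [4 * e + e] is the required radius. *)
    have /hasP[j _ /andP[/asboolP ij /asboolP gj]] :
        has (predI (close i) (fun j => good (hs j))) (iota 0 m).
      by apply: count_cap_majority; rewrite size_iota; lia.
    have := dTV_triangle P (den (hs j)) (den (hs i)).
    by rewrite (dTV_sym (den (hs j))); lra.
  - by rewrite size_rcons.
  - by rewrite -cats1 count_cat /= addn0 leq_add2r.
apply: (prob_Ret A B P) => //; split; rewrite ?count_iotaS //=.
  exact: leq_trans sz _.
case: (boolP (good (hs i))) => [/cg cm|]; last by rewrite addn0.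
(* A good candidate collects more than [m / 2] votes, so twice its tally is at least [m + 1], above
   [n]: the test could not have failed. *)
case/negP: nc; apply: le_trans (ltW mn2) _.
by rewrite natr1 -natrM ler_nat; lia.
Qed.

Lemma prob_vote i Tm s : (i < m)%N -> voting hs Tm s -> elected i s ->
  (((1 - dl) ^+ m)%:E <=
    prob (elected i.+1) (exec vote (tick 1 (set_reg 5 i%:R s))))%E.
Proof.
move=> im Qs Es; rewrite /vote exec_Assign_Seq exec_Seq.
have Qs1 := voting_enter i Qs.
rewrite -[_ ^+ _]mulr1.
have /andP[? ?] := dl01.
apply: (prob_bind _ _ (all_runs_vote_loop tA tB im Qs1) (prob_vote_loop im Qs1 _)).
- by rewrite exprn_ge0//; lra.
- by [].
- by exists 0%N.
- by move=> t Qt St; exact: prob_emit_step Qt St erefl Es.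
Qed.

Lemma prob_votes Tm s : voting hs Tm s -> elected 0 s ->
  (((1 - dl) ^+ (m * m))%:E <=
    prob (elected m) (exec (For 5 (Reg 2) vote) s))%E.
Proof.
move=> Qs Es; have fs : frame n e dl s by case: Qs.
rewrite exec_For (frame_addr fs) exprM.
pose Q k := voting hs (k * vote_time tB n e dl + 2 + Tm).
have /andP[? ?] := dl01.
apply: (@prob_iterate _ _ _ _ _ A B P _ Q elected _ _ _ 0).
- by rewrite exprn_ge0 ?exprn_ile1//; lra.
- move=> j s' jm; rewrite /Q mulSn -2!(addnA (vote_time _ _ _ _)) => ?.
  by apply: all_runs_vote.
- by move=> j s' jm Qs' Ss'; exact: prob_vote Qs' Ss'.
- by case: Qs => *; split.
- by [].
Qed.

End success.

Section tournament_success.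
Context d (X : measurableType d) dH (H : measurableType dH) (R : realType).
Variables (den : H -> probability X R) (D : set (probability X R)).
Variables (A : learner X H R) (B : approximator H R) (P : probability X R).

Lemma prob_tournament (n eps dl : R) Tm s :
  learns den D A -> approximates den B -> D P ->
  0 < eps / 4 < 1 -> 0 < dl < 1 ->
  (0 < Num.truncn n)%N -> (Num.truncn n)%:R <= n < (Num.truncn n)%:R + 1 ->
  deviation R 0 (Num.truncn n) (Num.truncn n) <= 1 ->
  sampling (@lrn_samples _ _ _ _ _ A) n (eps / 4) dl Tm 0 s ->
  (((1 - deviation R 0 (Num.truncn n) (Num.truncn n)) *
      (1 - dl) ^+ (Num.truncn n * Num.truncn n))%:E <=
  prob A B P (fun s' => exists2 Phat : probability X R,
      returned den s' = Some Phat & (dTV P Phat <= eps)%R)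
    (exec (@lrn_time _ _ _ _ _ A) (@lrn_samples _ _ _ _ _ A)
       (@apx_time _ _ _ B) tournament s))%E.
Proof.
move=> lA aB DP e01 dl01 m0 mn dev1 Qs.
have : eps = 4 * (eps / 4) by field.
move: (eps / 4) e01 Qs => e e01 Qs ->.
have /andP[? ?] := dl01.
have q0 : 0 <= (1 - dl) ^+ (Num.truncn n * Num.truncn n).
  by rewrite exprn_ge0//; lra.
rewrite /tournament exec_Seq.
apply: (prob_bind _ q0 (all_runs_samples _ _ Qs) (prob_samples B lA DP e01 Qs)).
  by rewrite subr_ge0.
(* Sampling is now over: fix a final state with a good majority and treat its specifications as
   constants. *)
move=> t Qt; have [hs Vt] := sampling_voting m0 Qt => maj.
have maj' : (Num.truncn n <
    2 * count (fun i => good den P e (hs i)) (iota 0 (Num.truncn n)))%N.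
  apply: leq_trans maj _; rewrite leq_mul2l /= /good_cells.
  apply: eq_leq; apply: eq_in_count => i; rewrite mem_iota add0n => /andP[_ im].
  by case: Vt => _ cs _ _ _; rewrite cs.
rewrite exec_Seq -[_ ^+ _]mulr1.
apply: (prob_bind q0 ler01 (all_runs_votes _ _ Vt) (prob_votes aB e01 maj' dl01 mn Vt _)).
  by case: Qt => _ _ [nil_out _] _ _; split; rewrite ?nil_out.
by move=> t' Qt' Et'; exact: (prob_fallback B e01 maj' Qt' Et').
Qed.

End tournament_success.

(** * Assembling the program and its asymptotic bounds *)

Lemma exec_setup (R : realType) (H : Type) (tA mA : R -> nat)
    (tB : R -> R -> nat) (eps delta : R) :
  exists2 s, exec tA mA tB setup (Defs.init H eps delta) = Ret R H s &
    sampling mA (10 * ln (2 / delta)) (eps / 4)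
      (delta / (21 * 10 ^+ 4 * ln (2 / delta) ^+ 2)) 29 0 s.
Proof.
eexists; first by [].
split=> //; split=> //=; rewrite /Defs.eval /= /upd /=.
by rewrite (_ : 100 * 100 = 10 ^+ 4) ?expr2//; lra.
Qed.

Lemma returned_neq_None d (X : measurableType d) (R : realType) (H : Type)
    (den : H -> probability X R) (s : state R H) :
  output s <> [::] -> returned den s <> None.
Proof. by rewrite /returned; case: (output s). Qed.

(** Additive constants are absorbed since [m], [tA] and [tB] are at least 1. Then 5 * 10 K = 50 K
    and 100 * (10 K)^2 = (100 K)^2 give the coefficients. *)
Lemma tournament_time_le (R : realType) (m tA tB : nat) (l K : R) :
  (0 < m)%N -> (0 < tA)%N -> (0 < tB)%N -> 0 <= l -> 0 <= K ->
  m%:R <= 10 * (K * l) ->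
  (m * (tA + 4) + m * (m * (tB + 15) + 16) + 9 + 29)%:R <=
    (50 * K + (100 * K) ^+ 2) * (tA%:R * l + tB%:R * l ^+ 2).
Proof.
move=> m0 tA0 tB0 l0 K0 mK.
have : (m * (tA + 4) + m * (m * (tB + 15) + 16) + 9 + 29 <=
    5 * (m * tA) + 100 * ((m * m) * tB))%N by nia.
rewrite -(ler_nat R) => /le_trans; apply.
rewrite natrD !natrM.
have mm : (m%:R * m%:R : R) <= 10 * (K * l) * (10 * (K * l)).
  by apply: ler_pM.
have h1 := ler_wpM2r (ler0n R tA) mK.
have h2 := ler_wpM2r (ler0n R tB) mm.
have x0 : 0 <= K * (tB%:R * l ^+ 2) by rewrite !mulr_ge0 ?exprn_ge0.
have y0 : 0 <= K ^+ 2 * (tA%:R * l) by rewrite !mulr_ge0 ?exprn_ge0.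
rewrite mulrDl !mulrDr; move: h1 h2 x0 y0; rewrite !expr2; lra.
Qed.

(* The O-bounds are as delta -> 0: log (1 / delta) vanishes at delta = 1, so
   they are uniform over delta <= delta0 for any fixed delta0 < 1; C depends on
   delta0 only. *)
Theorem theorem2p9 (R : realType) (delta0 : R) (hdelta0 : 0 < delta0 < 1) :
  exists C : R, 0 < C /\
  forall (d : measure_display) (X : measurableType d)
    (dH : measure_display) (H : measurableType dH)
    (den : H -> probability X R)
    (D : set (probability X R)) (A : learner X H R) (B : approximator H R),
  learns den D A ->
  approximates den B ->
  exists c : prog, forall eps delta : R, 0 < eps < 1 -> 0 < delta < 1 ->
    (forall P : probability X R, D P ->
       ((1 - delta)%:E <=
        prob A B P
          (fun s => exists2 Phat : probability X R,
             returned den s = Some Phat & (dTV P Phat <= eps)%R)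
          (run A B c eps delta))%E) /\
    all_runs (fun s => returned den s <> None) (run A B c eps delta) /\
    (delta <= delta0 ->
     all_runs (fun s =>
         (samples s)%:R <=
           C * ((lrn_samples A (eps / 4))%:R * ln (1 / delta)) /\
         (time s)%:R <=
           C * ((lrn_time A (eps / 4))%:R * ln (1 / delta) +
                (apx_time B (eps / 4)
                   (delta / (21 * 10 ^+ 4 * ln (2 / delta) ^+ 2)))%:R
                * ln (1 / delta) ^+ 2))
       (run A B c eps delta)).
Proof.
have l0_gt0 : 0 < ln (1 / delta0).
  by have /andP[? ?] := hdelta0; rewrite ln_gt0// ltr_pdivlMr// mul1r.
pose K : R := 1 + ln 2 / ln (1 / delta0).
have K_gt0 : 0 < K.
  have ln2_ge0 : 0 <= ln (2 : R) by apply: le_trans (ln2_ge_half R).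
  by rewrite /K ltr_pwDl// divr_ge0// ltW.
exists (50 * K + (100 * K) ^+ 2); split.
  by rewrite addr_gt0 ?exprn_gt0 ?mulr_gt0.
move=> d X dH H den D A B lA aB; exists (Seq setup tournament) => eps delta.
move=> /andP[eps0 eps1] delta01.
have e01 : 0 < eps / 4 < 1 by lra.
rewrite /run exec_Seq.
have [s -> Qs] := exec_setup H (@lrn_time _ _ _ _ _ A)
  (@lrn_samples _ _ _ _ _ A) (@apx_time _ _ _ B) eps delta.
have [m0 mn] := truncn_rounds delta01.
rewrite [bind _ _]/(exec _ _ _ tournament s).
have := all_runs_tournament (@lrn_time _ _ _ _ _ A) (@apx_time _ _ _ B) m0 Qs.
move=> runs; split; [|split].
- move=> P DP; have dl01 := failure_probability_bounds delta01.
  have dev1 := learner_failures delta01.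
  have /andP[delta_gt0 delta_lt1] := delta01.
  apply: (le_trans _ (prob_tournament lA aB DP e01 dl01 m0 mn _ Qs)); last first.
    by lra.
  by rewrite lee_fin; exact: success_probability.
(* Thanks to [fallback] this holds whatever the subroutines answer. *)
- by apply: all_runs_mono runs => t [/(@returned_neq_None _ _ _ _ den)].
move=> delta_le; have /andP[delta_gt0 delta_lt1] := delta01.
have l_ge0 : 0 <= ln (1 / delta).
  by rewrite ln_ge0// ler_pdivlMr// mul1r ltW.
have mK : (Num.truncn (10 * ln (2 / delta)))%:R <= 10 * (K * ln (1 / delta)).
  have /andP[+ _] := mn; move=> /le_trans; apply.
  by rewrite ler_pM2l// ln_2div_le// delta_gt0.
apply: all_runs_mono runs => t [_ -> tt]; split.
  rewrite natrM [leLHS]mulrC [leRHS]mulrCA ler_wpM2l//.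
  have : 0 <= K * ln (1 / delta) by rewrite mulr_ge0 ?(ltW K_gt0).
  have : 0 <= (100 * K) ^+ 2 * ln (1 / delta).
    by rewrite mulr_ge0 ?exprn_ge0 ?mulr_ge0 ?(ltW K_gt0).
  rewrite mulrDl; lra.
apply: le_trans (tournament_time_le m0 (lrn_time_gt0 A _) (apx_time_gt0 B _ _)
  l_ge0 (ltW K_gt0) mK).
by rewrite ler_nat.
Qed.
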